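(* Let $\mathbf U=(D,\boldsymbol m,E)^\top\in G_u$ and let $p(\mathbf U)$ be the unique positive solution of $\Phi_{\mathbf U}(p)=0$. Put $$p_R^{(0)}=(\Gamma-1)\Big(E-D\sqrt{1-\tfrac{\|\boldsymbol m\|^2}{E^2}}\Big),\qquad \delta=(\Gamma-1)\frac{\|\boldsymbol m\|^2}{E^2},$$ and define the iteration $$p^{(0)}=\tfrac12p_R^{(0)},\qquad p^{(n)}=-(\Gamma-1)\,\Phi_{\mathbf U}\big(p^{(n-1)}\big)+p^{(n-1)},\quad n=1,2,\dots$$ Then $0\le\delta<1$, $p^{(n)}>0$ for all $n\ge0$, and $$\big|p^{(n)}-p(\mathbf U)\big|\le\delta^n\big|p^{(0)}-p(\mathbf U)\big|\le\delta^n\,\frac{p_R^{(0)}}{2}\qquad\text{for all } n\ge 0;$$ in particular $\lim_{n\to+\infty}p^{(n)}=p(\mathbf U)$.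
   Context: Fix $\Gamma\in(1,2]$; $\|\cdot\|$ is the Euclidean norm on $\mathbb R^2$. For $\mathbf U=(D,\boldsymbol m,E)^\top\in\mathbb R^4$ with $\boldsymbol m\in\mathbb R^2$, $$\Phi_{\mathbf U}(p)=\frac{p}{\Gamma-1}-E+\frac{\|\boldsymbol m\|^2}{E+p}+D\sqrt{1-\frac{\|\boldsymbol m\|^2}{(E+p)^2}},\qquad p\in[0,\infty).$$ $p(\mathbf U)$ denotes the solution in $[0,\infty)$ of $\Phi_{\mathbf U}(p)=0$, $\boldsymbol v(\mathbf U)=\boldsymbol m/(E+p(\mathbf U))$, $\rho(\mathbf U)=D\sqrt{1-\|\boldsymbol v(\mathbf U)\|^2}$, and $G_u=\{\mathbf U\in\mathbb R^4:\rho(\mathbf U)>0,\ p(\mathbf U)>0,\ \|\boldsymbol v(\mathbf U)\|<1\}$. It is known that $G_u=\{\mathbf U:D>0,\ E>\sqrt{D^2+\|\boldsymbol m\|^2}\}$. Convention: $0^0=1$. *)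

(* Defs.v *)
From mathcomp Require Export all_boot all_order all_algebra.
From mathcomp Require Export all_classical all_reals all_analysis.
Export Order.TTheory GRing.Theory Num.Theory.
Export numFieldNormedType.Exports.

Set Implicit Arguments.
Unset Strict Implicit.
Unset Printing Implicit Defensive.

Local Open Scope classical_set_scope.
Local Open Scope ring_scope.

(* The library norm on matrices is the sup norm. *)
Definition enorm {R : realType} {n : nat} (x : 'cV[R]_n) : R :=
  Num.sqrt (\sum_(i < n) x i 0 ^+ 2).

(* U = (D, m, E)^T in R^4, with D and E in R and m in R^2. *)
Record state (R : realType) := State {
  dens : R;
  mom : 'cV[R]_2;
  energy : R }.

Definition Phi {R : realType} (Gamma : R) (U : state R) (p : R) : R :=
  p / (Gamma - 1) - energy U + enorm (mom U) ^+ 2 / (energy U + p)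
  + dens U * Num.sqrt (1 - enorm (mom U) ^+ 2 / (energy U + p) ^+ 2).

(* The value is 0 when Phi has no root in [0, +oo[; such states are excluded
   from G_u by the condition 0 < pressure. *)
Definition pressure {R : realType} (Gamma : R) (U : state R) : R :=
  xget 0 [set p : R | 0 <= p /\ Phi Gamma U p = 0].

Definition velocity {R : realType} (Gamma : R) (U : state R) : 'cV[R]_2 :=
  (energy U + pressure Gamma U)^-1 *: mom U.

Definition density {R : realType} (Gamma : R) (U : state R) : R :=
  dens U * Num.sqrt (1 - enorm (velocity Gamma U) ^+ 2).

(* For 1 < Gamma <= 2 the conventions x / 0 = 0 and sqrt x = 0 for x < 0 add no
   state to G_u: if 0 < D, 0 < p, |v| < 1 and Phi p = 0, then
   (E + p) (1 - |v|^2) = p + p / (Gamma - 1) + D sqrt (1 - |v|^2) > 0, whence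
   E > sqrt (D^2 + |m|^2), and then Phi is a genuine expression on [0, +oo[
   and is strictly increasing there. *)
Definition G_u {R : realType} (Gamma : R) : set (state R) :=
  [set U | [/\ 0 < density Gamma U, 0 < pressure Gamma U &
               enorm (velocity Gamma U) < 1]].

Definition pR0 {R : realType} (Gamma : R) (U : state R) : R :=
  (Gamma - 1) *
  (energy U
   - dens U * Num.sqrt (1 - enorm (mom U) ^+ 2 / energy U ^+ 2)).

Definition contraction_rate {R : realType} (Gamma : R) (U : state R) : R :=
  (Gamma - 1) * (enorm (mom U) ^+ 2 / energy U ^+ 2).

Fixpoint pressure_iter {R : realType} (Gamma : R) (U : state R) (n : nat) : R :=
  match n with
  | 0%N => 2^-1 * pR0 Gamma U
  | n'.+1 => - (Gamma - 1) * Phi Gamma U (pressure_iter Gamma U n')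
             + pressure_iter Gamma U n'
  end.

(* Main.v *)
Require Import Defs.
From mathcomp Require Import ring lra.

Set Implicit Arguments.
Unset Strict Implicit.
Unset Printing Implicit Defensive.

Local Open Scope classical_set_scope.
Local Open Scope ring_scope.

(** Write [a = Gamma - 1], [M = |m| ^ 2] and [w p = sqrt (1 - M / (E + p) ^ 2)].
    In [p - a * Phi p] the linear term of [Phi] cancels, so the iteration is
    [p' = f p] with [f p = a * (E - M / (E + p) - D * w p)] ([step], [step_Phi]),
    and the roots of [Phi] are the fixed points of [f].  The derivative of [f],
    [a * (M / (E + p) ^ 2) * (1 - D / ((E + p) * w p))], lies in [[0, delta]] on
    the half-line [p >= 0], because [D ^ 2 + M < E ^ 2] gives
    [D < (E + p) * w p].  Hence [f] is nondecreasing and [delta]-Lipschitz there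
    ([step_incr], [step_contract]).

    Monotonicity with [f 0 > 0] keeps every iterate positive ([step_gt0]); the
    contraction gives uniqueness of the positive root and the geometric rate,
    with [delta < 1] since [a <= 1] and [M < E ^ 2]; and the bound
    [f p <= pR0] ([step_le]) puts the root in [[0, pR0]], whose midpoint is the
    initial guess.

    The states are given through the root itself, so the inequality
    [D ^ 2 + M < E ^ 2] has to be recovered from the root equation; that is
    [root_admissible], and it uses [Gamma <= 2]. *)

Lemma enormZ_sqr (R : realType) n (c : R) (x : 'cV[R]_n) :
  enorm (c *: x) ^+ 2 = c ^+ 2 * enorm x ^+ 2.
Proof.
rewrite !sqr_sqrtr ?sumr_ge0 // => [|i _|i _]; rewrite ?sqr_ge0 //.
by rewrite mulr_sumr; apply: eq_bigr => i _; rewrite mxE exprMn.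
Qed.

(** * The inverse Lorentz factor *)

(** With [M] the squared momentum and [x = E + p], the velocity is [m / x], so
    this is the inverse Lorentz factor at pressure [p]. *)
Definition inv_lorentz (R : realType) (M x : R) : R :=
  Num.sqrt (1 - M / x ^+ 2).

Lemma inv_lorentz_ge0 (R : realType) (M x : R) : 0 <= inv_lorentz M x.
Proof. exact: sqrtr_ge0. Qed.

Lemma inv_lorentz_sqr (R : realType) (M x : R) :
  0 < x -> M <= x ^+ 2 -> x ^+ 2 * inv_lorentz M x ^+ 2 = x ^+ 2 - M.
Proof.
move=> x0 Mx; have x20 : 0 < x ^+ 2 by rewrite exprn_gt0.
rewrite sqr_sqrtr; last by rewrite subr_ge0 ler_pdivrMr ?mul1r.
by field; lra.
Qed.

Lemma inv_lorentz_le1 (R : realType) (M x : R) : 0 <= M -> inv_lorentz M x <= 1.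
Proof.
move=> M0; rewrite -[leRHS]sqrtr1 ler_wsqrtr // gerBl.
by rewrite mulr_ge0 // invr_ge0 sqr_ge0.
Qed.

Lemma inv_lorentz_le (R : realType) (M x y : R) :
  0 <= M -> 0 < x -> x <= y -> inv_lorentz M x <= inv_lorentz M y.
Proof.
move=> M0 x0 xy; apply: ler_wsqrtr; rewrite lerD2l lerN2.
apply: ler_wpM2l => //; rewrite lef_pV2 ?posrE ?exprn_gt0 //; last lra.
by rewrite lerXn2r // nnegrE; lra.
Qed.

(** * Admissible states *)

(** The explicit description of the physical states: [D > 0] and
    [E > sqrt (D ^ 2 + |m| ^ 2)], in terms of [M = |m| ^ 2]. *)
Definition admissible (R : realType) (M D E : R) : Prop :=
  [/\ 0 <= M, 0 < D, 0 < E & D ^+ 2 + M < E ^+ 2].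

(** Write [x = E + p], [w] for the inverse Lorentz factor at [x], so that
    [M = x ^ 2 (1 - w ^ 2)].  The root equation becomes
    [p / a + p + D w = x w ^ 2], whence [x w > D] and, as [a <= 1],
    [p <= (x w ^ 2 - D w) / 2].  Thus [E] is at least
    [x - (x w ^ 2 - D w) / 2], and the square of this bound exceeds
    [D ^ 2 + M] by
    [w ^ 2 (x w - D) ^ 2 / 4 + D (x w - D)], which is positive. *)
Lemma root_admissible (R : realType) (M a D E p : R) :
  0 <= M -> 0 < a <= 1 -> 0 < D -> 0 < p -> M < (E + p) ^+ 2 ->
  p / a - E + M / (E + p) + D * inv_lorentz M (E + p) = 0 ->
  admissible M D E.
Proof.
move=> M0 /andP[a0 a1] D0 p0; move Ep : (E + p) => x Mx.
have {Ep}-> : E = x - p by rewrite -Ep; ring.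
have x20 : 0 < x ^+ 2 := le_lt_trans M0 Mx.
have xn0 : x != 0 by apply: contraTneq x20 => ->; rewrite expr0n ltxx.
have wpos : 0 < inv_lorentz M x.
  by rewrite sqrtr_gt0 subr_gt0 ltr_pdivrMr ?mul1r.
have w2 : inv_lorentz M x ^+ 2 = 1 - M / x ^+ 2.
  by rewrite sqr_sqrtr // subr_ge0 ler_pdivrMr ?mul1r // ltW.
have MxE : M = x ^+ 2 * (1 - inv_lorentz M x ^+ 2) by rewrite w2; field.
have w1 := inv_lorentz_le1 x M0.
move: (inv_lorentz M x) wpos w1 MxE => w w0 w1 ME {w2}.
have -> : M / x = x * (1 - w ^+ 2) by rewrite ME; field.
move=> H.
have pa : p <= p / a by rewrite ler_pdivlMr //; nra.
have Dw : 0 < D * w by rewrite mulr_gt0.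
have xw2 : 2 * p + D * w <= x * w ^+ 2 by lra.
have w20 : 0 < w ^+ 2 by rewrite exprn_gt0.
have x0 : 0 < x by rewrite -(pmulr_lgt0 _ w20); lra.
have yD : D < x * w by rewrite -(ltr_pM2r w0); lra.
have E1 : x - (x * w ^+ 2 - D * w) / 2 <= x - p by lra.
have w21 : w ^+ 2 <= 1 by nra.
have E0 : 0 < x - (x * w ^+ 2 - D * w) / 2 by nra.
split=> //; first lra.
apply: (@lt_le_trans _ _ ((x - (x * w ^+ 2 - D * w) / 2) ^+ 2)); last first.
  by rewrite lerXn2r // nnegrE; lra.
rewrite -subr_gt0.
have -> : (x - (x * w ^+ 2 - D * w) / 2) ^+ 2 - (D ^+ 2 + M)
   = w ^+ 2 / 4 * (x * w - D) ^+ 2 + D * (x * w - D) by rewrite ME; field.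
by apply: ltr_wpDl; [rewrite !mulr_ge0 ?sqr_ge0 //; lra | rewrite mulr_gt0 ?subr_gt0].
Qed.

Lemma admissible_shift (R : realType) (M D E p : R) :
  admissible M D E -> 0 <= p -> admissible M D (E + p).
Proof.
move=> [M0 D0 E0 HE] p0; split=> //; first by rewrite ltr_wpDr.
apply: lt_le_trans HE _.
by rewrite lerXn2r ?nnegrE ?addr_ge0 ?lerDl //; exact: ltW.
Qed.

Lemma admissible_sqr (R : realType) (M D E : R) : admissible M D E ->
  E ^+ 2 * inv_lorentz M E ^+ 2 = E ^+ 2 - M.
Proof.
move=> [M0 D0 E0 HE]; apply: inv_lorentz_sqr => //.
by have := sqr_ge0 D; lra.
Qed.

(** Both sides are nonnegative and the square of the right one is
    [E ^ 2 - M]. *)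
Lemma admissible_lorentz (R : realType) (M D E : R) : admissible M D E ->
  D < E * inv_lorentz M E.
Proof.
move=> adm; have w2 := admissible_sqr adm; case: adm => M0 D0 E0 HE.
rewrite -(@ltr_pXn2r _ 2) ?nnegrE ?exprMn ?mulr_ge0 ?inv_lorentz_ge0 // ?w2; lra.
Qed.

(** * The iteration map *)

Definition step (R : realType) (M a D E p : R) : R :=
  a * (E - M / (E + p) - D * inv_lorentz M (E + p)).

(** With [x = E + p], the derivative of the step is
    [a (M / x ^ 2) (1 - D / (x w))], which lies in [[0, a M / E ^ 2]] because
    [D < x w].  The proof is the finite-difference version: for [x < y] with
    factors [u <= v], the difference [v - u] equals
    [(M / x - M / y) (1 / x + 1 / y) / (u + v)], and
    [D / x <= u], [D / y <= v]. *)
Lemma step_incr (R : realType) (M a D E p q : R) :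
  0 < a -> admissible M D E -> 0 <= p -> p <= q ->
  0 <= step M a D E q - step M a D E p <= a * (M / E ^+ 2) * (q - p).
Proof.
move=> a0 adm p0 pq; rewrite /step -mulrBr -mulrA pmulr_rge0 // ler_pM2l //.
have admx := admissible_shift adm p0.
have admy := admissible_shift adm (le_trans p0 pq).
have [M0 D0 E0 _] := adm.
move xE : (E + p) admx => x admx; move yE : (E + q) admy => y admy.
have [_ _ x0 _] := admx; have [_ _ y0 _] := admy.
have xw := admissible_lorentz admx; have yw := admissible_lorentz admy.
have wx2 := admissible_sqr admx; have wy2 := admissible_sqr admy.
have xy : x <= y by lra.
have wxy := inv_lorentz_le M0 x0 xy.
have x20 : 0 < x ^+ 2 by rewrite exprn_gt0.
have y20 : 0 < y ^+ 2 by rewrite exprn_gt0.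
have xV : M / x - M / y = M / (x * y) * (q - p).
  by rewrite (_ : q - p = y - x); [field; rewrite !gt_eqF|lra].
move: (inv_lorentz M x) (inv_lorentz M y) xw yw wx2 wy2 wxy => u v xw yw wx2 wy2 wxy.
apply/andP; split.
- have u0 : 0 < u by rewrite -(pmulr_rgt0 _ x0); lra.
  have v0 : 0 < v by lra.
  have Dx : D / x <= u by rewrite ler_pdivrMr // mulrC ltW.
  have Dy : D / y <= v by rewrite ler_pdivrMr // mulrC ltW.
  have uE : u ^+ 2 = 1 - M / x ^+ 2.
    apply: (@mulfI _ (x ^+ 2)); first by rewrite gt_eqF.
    by rewrite wx2; field; rewrite gt_eqF.
  have vE : v ^+ 2 = 1 - M / y ^+ 2.
    apply: (@mulfI _ (y ^+ 2)); first by rewrite gt_eqF.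
    by rewrite wy2; field; rewrite gt_eqF.
  have diff : (v - u) * (u + v) = (M / x - M / y) * (x^-1 + y^-1).
    rewrite (_ : _ * _ = v ^+ 2 - u ^+ 2); last by ring.
    by rewrite uE vE; field; rewrite !gt_eqF.
  have MV0 : 0 <= M / x - M / y.
    rewrite xV mulr_ge0 ?subr_ge0 //.
    by rewrite divr_ge0 ?mulr_ge0 // ltW.
  suff : D * (v - u) <= M / x - M / y by lra.
  rewrite -(@ler_pM2r _ (u + v)) ?addr_gt0 // -mulrA diff mulrCA.
  by apply: ler_wpM2l => //; rewrite mulrDr; lra.
- have : M / (x * y) <= M / E ^+ 2.
    apply: ler_wpM2l => //; rewrite lef_pV2 ?posrE ?exprn_gt0 ?mulr_gt0 //.
    by rewrite expr2 ler_pM //; lra.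
  have qp0 : 0 <= q - p by rewrite subr_ge0.
  move=> /(ler_wpM2r qp0).
  by have : D * u <= D * v; [rewrite ler_pM2l|lra].
Qed.

Lemma step_contract (R : realType) (M a D E p q : R) :
  0 < a -> admissible M D E -> 0 <= p -> 0 <= q ->
  `|step M a D E p - step M a D E q| <= a * (M / E ^+ 2) * `|p - q|.
Proof.
move=> a0 adm p0 q0; wlog pq : p q p0 q0 / p <= q => [H|].
  by case/orP: (le_total p q) => ?; [exact: H|rewrite distrC (distrC p); exact: H].
case/andP: (step_incr a0 adm p0 pq) => h1 h2.
by rewrite distrC (distrC p) !ger0_norm // subr_ge0.
Qed.

(** By monotonicity it is enough to look at [p = 0], where the value is
    [a w (E w - D)] with [w] the inverse Lorentz factor at [E]. *)
Lemma step_gt0 (R : realType) (M a D E p : R) :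
  0 < a -> admissible M D E -> 0 <= p -> 0 < step M a D E p.
Proof.
move=> a0 adm p0; have /andP[h _] := step_incr a0 adm (lexx 0) p0.
suff : 0 < step M a D E 0 by lra.
rewrite /step addr0 pmulr_rgt0 //.
have Ew := admissible_lorentz adm; have w2 := admissible_sqr adm.
have [M0 D0 E0 _] := adm.
have w0 : 0 < inv_lorentz M E by rewrite -(pmulr_rgt0 _ E0); lra.
move: (inv_lorentz M E) Ew w2 w0 => w Ew w2 w0.
have -> : M = E ^+ 2 * (1 - w ^+ 2) by lra.
have -> : E - E ^+ 2 * (1 - w ^+ 2) / E - D * w = w * (E * w - D).
  by field; rewrite gt_eqF.
by rewrite mulr_gt0 ?subr_gt0.
Qed.

(** The right-hand side is twice the initial guess, so every fixed point of the
    step lies between 0 and twice that guess. *)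
Lemma step_le (R : realType) (M a D E p : R) :
  0 < a -> admissible M D E -> 0 <= p ->
  step M a D E p <= a * (E - D * inv_lorentz M E).
Proof.
move=> a0 [M0 D0 E0 _] p0; rewrite /step ler_pM2l //.
have : D * inv_lorentz M E <= D * inv_lorentz M (E + p).
  by rewrite ler_pM2l // inv_lorentz_le //; lra.
have : 0 <= M / (E + p) by rewrite mulr_ge0 // invr_ge0; lra.
lra.
Qed.

(** * Physical states and the root equation *)

(** The factor [Gamma - 1] turns the linear term of [Phi] into [p], which the
    update cancels. *)
Lemma step_Phi (R : realType) (Gamma : R) (U : state R) (p : R) :
  1 < Gamma ->
  - (Gamma - 1) * Phi Gamma U p + p =
  step (enorm (mom U) ^+ 2) (Gamma - 1) (dens U) (energy U) p.
Proof.
move=> G1; have G0 : Gamma - 1 != 0 by lra.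
rewrite /Phi /step /inv_lorentz.
set s := Num.sqrt _; set q := _ / (energy U + p).
by field.
Qed.

(** A positive pressure is not the default value 0, so it was chosen among the
    roots. *)
Lemma pressureP (R : realType) (Gamma : R) (U : state R) :
  0 < pressure Gamma U -> Phi Gamma U (pressure Gamma U) = 0.
Proof. by rewrite /pressure; case: xgetP => [y _ []//|_]; rewrite ltxx. Qed.

Lemma G_u_admissible (R : realType) (Gamma : R) (U : state R) :
  1 < Gamma <= 2 -> G_u Gamma U ->
  admissible (enorm (mom U) ^+ 2) (dens U) (energy U).
Proof.
move=> /andP[G1 G2] [rho0 p0 v1].
have Phi0 := pressureP p0.
have D0 : 0 < dens U.
  rewrite ltNge; apply/negP => D0; move: rho0.
  by rewrite ltNge mulr_le0_ge0 ?sqrtr_ge0.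
set x := energy U + pressure Gamma U.
have v2 : enorm (velocity Gamma U) ^+ 2 = enorm (mom U) ^+ 2 / x ^+ 2.
  by rewrite enormZ_sqr exprVn mulrC.
(* At [x = 0] the divisions take their default value 0, and the equation would
   read [p / (Gamma - 1) + p + D = 0] with all three terms positive. *)
have x0 : x != 0.
  apply/eqP => x0.
  have : 0 < pressure Gamma U / (Gamma - 1) by rewrite divr_gt0 // subr_gt0.
  move: Phi0; rewrite /Phi -/x x0 expr0n /= invr0 !mulr0 subr0 sqrtr1.
  by move: x0; rewrite /x; lra.
have Mx : enorm (mom U) ^+ 2 < x ^+ 2.
  have x20 : 0 < x ^+ 2 by rewrite exprn_even_gt0.
  rewrite -[ltRHS]mul1r -ltr_pdivrMr // -v2 expr_lt1 //.
  exact: sqrtr_ge0.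
by apply: (root_admissible (sqr_ge0 _) _ D0 p0 Mx Phi0); lra.
Qed.

(** * Iterating a contraction *)

Lemma contraction_iter_dist (R : realType) (f : R -> R) (p : nat -> R) (c d : R) :
  (forall n, p n.+1 = f (p n)) -> f c = c -> 0 <= d ->
  (forall n, `|f (p n) - f c| <= d * `|p n - c|) ->
  forall n, `|p n - c| <= d ^+ n * `|p 0%N - c|.
Proof.
move=> pS fc d0 H; elim=> [|n IH]; first by rewrite expr0 mul1r.
rewrite pS -{1}fc (le_trans (H n)) // exprS -mulrA.
exact: ler_wpM2l.
Qed.

Lemma geometric_dist_cvg (R : realType) (p : nat -> R) (c d B : R) :
  0 <= d < 1 -> (forall n, `|p n - c| <= d ^+ n * B) ->
  p n @[n --> \oo] --> c.
Proof.
move=> /andP[d0 d1] H; apply/cvgrPdist_le => e e0.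
have := @cvg_geometric R B d; rewrite ger0_norm // => /(_ d1) /cvgr0Pnorm_le /(_ e e0).
apply: filterS => n /=; rewrite distrC => h; apply: le_trans (H n) _.
by rewrite mulrC; apply: le_trans (ler_norm _) h.
Qed.

(** * Convergence of the pressure iteration *)

Theorem mainTheorem4 (R : realType) (Gamma : R) (hGamma : 1 < Gamma <= 2)
    (U : state R) (hU : G_u Gamma U) :
  let pU := pressure Gamma U in
  let delta := contraction_rate Gamma U in
  let p := pressure_iter Gamma U in
  [/\ [/\ 0 < pU, Phi Gamma U pU = 0 &
          forall q : R, 0 < q -> Phi Gamma U q = 0 -> q = pU],
      0 <= delta < 1,
      forall n : nat, 0 < p n,
      forall n : nat,
        `|p n - pU| <= delta ^+ n * `|p 0%N - pU| /\
        delta ^+ n * `|p 0%N - pU| <= delta ^+ n * (pR0 Gamma U / 2) &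
      p n @[n --> \oo] --> pU].
Proof.
move=> pU delta p.
have adm := G_u_admissible hGamma hU; have [_ D0 E0 HE] := adm.
have pU0 : 0 < pU by case: hU.
have PhiU : Phi Gamma U pU = 0 := pressureP pU0.
have /andP[G1 G2] := hGamma; have a0 : 0 < Gamma - 1 by lra.
pose M := enorm (mom U) ^+ 2; have M0 : 0 <= M := sqr_ge0 _.
pose f := step M (Gamma - 1) (dens U) (energy U).
have fixed q : Phi Gamma U q = 0 -> f q = q.
  by move=> h; rewrite /f -step_Phi // h mulr0 add0r.
have fU : f pU = pU := fixed _ PhiU.
have pS n : p n.+1 = f (p n) by rewrite /f -step_Phi.
have E20 : 0 < energy U ^+ 2 by rewrite exprn_gt0.
have ME0 : 0 <= M / energy U ^+ 2 by rewrite divr_ge0 // ltW.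
have ME1 : M / energy U ^+ 2 < 1.
  by rewrite ltr_pdivrMr // mul1r /M; have := sqr_ge0 (dens U); lra.
have delta01 : 0 <= delta < 1.
  rewrite /delta /contraction_rate -/M; apply/andP; split; first by rewrite mulr_ge0 // ltW.
  by nra.
have /andP[d0 d1] := delta01.
have contract q r : 0 <= q -> 0 <= r -> `|f q - f r| <= delta * `|q - r|.
  exact: step_contract a0 adm.
have pUR : pU <= pR0 Gamma U.
  by rewrite -fU; apply: (step_le a0 adm); exact: ltW.
have p_gt0 n : 0 < p n.
  elim: n => [|n IH]; last by rewrite pS; apply: step_gt0 a0 adm _; exact: ltW.
  by rewrite /p /= mulr_gt0 ?invr_gt0 //; lra.
have dist n : `|p n - pU| <= delta ^+ n * `|p 0%N - pU|.
  by apply: (contraction_iter_dist pS fU d0) => k; apply: contract; exact: ltW.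
split=> //.
- split=> // q q0 /fixed fq; apply/eqP; rewrite -subr_eq0 -normr_eq0.
  have := contract q pU (ltW q0) (ltW pU0); rewrite fq fU => h.
  by rewrite eq_le normr_ge0 andbT; have := normr_ge0 (q - pU); nra.
- move=> n; split=> //; apply: ler_wpM2l; first exact: exprn_ge0.
  (* The root lies in [[0, pR0]] and [p 0] is the midpoint. *)
  by rewrite /p /= ler_norml; lra.
- exact: geometric_dist_cvg delta01 dist.
Qed.
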